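(* Let $\{\Gamma_t\}_{t\ge0}$ be an axisymmetric surface evolution by horizontal mean curvature flow in $\mathcal{H}$. If $\Gamma_0\subset B_r$ for some $r>0$, then $\Gamma_t=\emptyset$ for all $t>r^2/\sqrt{12}$.
   Context: The Heisenberg group $\mathcal{H}$ is $\mathbb{R}^3$ with the multiplication $(p_1,p_2,p_3)\cdot(q_1,q_2,q_3)=(p_1+q_1,\,p_2+q_2,\,p_3+q_3+\tfrac12(p_1q_2-q_1p_2))$ and Korányi gauge $|p|=((p_1^2+p_2^2)^2+16p_3^2)^{1/4}$; $B_r=\{p:|p|<r\}$. Set $X_1=\partial_{p_1}-\tfrac{p_2}{2}\partial_{p_3}$, $X_2=\partial_{p_2}+\tfrac{p_1}{2}\partial_{p_3}$, $\nabla_Hu=(X_1u,X_2u)$, and let $(\nabla_H^2u)^\ast$ be the symmetric $2\times2$ matrix with diagonal entries $X_1^2u$, $X_2^2u$ and off-diagonal entries $\tfrac12(X_1X_2u+X_2X_1u)$. Viscosity solutions. For $\eta\in\mathbb{R}^2\setminus\{0\}$ and a symmetric $2\times 2$ matrix $Y$ put $F(\eta,Y)=-\operatorname{tr}\big((I-\frac{\eta\otimes\eta}{|\eta|^2})Y\big)$. Let $\mathcal{O}\subset\mathcal{H}\times(0,\infty)$ be open. An upper (resp. lower) semicontinuous, extended-real-valued function $u$ on $\mathcal{O}$ is a subsolution (resp. supersolution) in $\mathcal{O}$ of $u_t+F(\nabla_Hu,(\nabla_H^2u)^\ast)=0$ if (i) $u<\infty$ (resp. $u>-\infty$) in $\mathcal{O}$;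 and (ii) whenever $\phi$ is a smooth function on $\mathcal{O}$ and $u-\phi$ attains a (finite) maximum (resp. minimum) over $\mathcal{O}$ at $(\hat p,\hat t)$, then at $(\hat p,\hat t)$: $\phi_t+F(\nabla_H\phi,(\nabla_H^2\phi)^\ast)\le0$ (resp. $\ge0$) if $\nabla_H\phi\ne0$; and $\phi_t\le0$ (resp. $\ge0$) if $\nabla_H\phi=0$ and $(\nabla_H^2\phi)^\ast=0$. A solution is both a subsolution and a supersolution. Axisymmetric (about the vertical axis): invariant when $(p_1,p_2,p_3)$ is replaced by $(p_1',p_2',p_3)$ with $(p_1')^2+(p_2')^2=p_1^2+p_2^2$ (for each fixed $t$). Axisymmetric surface evolution: $\Gamma_0\subset\mathcal{H}$ is compact and axisymmetric; $u_0\in C(\mathcal{H})$ is axisymmetric, constant outside a compact set, with $\Gamma_0=\{p:u_0(p)=0\}$; $u\in C(\mathcal{H}\times[0,\infty))$ is the unique spatially axisymmetric function with $u(\cdot,0)=u_0$ that solves $u_t+F(\nabla_Hu,(\nabla_H^2u)^\ast)=0$ in $\mathcal{H}\times(0,\infty)$ and, for each $T>0$, is equal to a constant on $(\mathcal{H}\setminus K_T)\times[0,T]$ for some compact $K_T$; and $\Gamma_t=\{p\in\mathcal{H}:u(p,t)=0\}$ for $t\ge0$. (The sets $\Gamma_t$ do not depend on the choice of $u_0$.) *)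

(* Defs.v *)
From HB Require Import structures.
From mathcomp Require Import all_boot all_order all_algebra.
From mathcomp Require Import all_classical all_reals all_analysis.
Set Implicit Arguments.
Unset Strict Implicit.
Unset Printing Implicit Defensive.
Import Order.TTheory GRing.Theory Num.Theory.
Import numFieldNormedType.Exports.
Local Open Scope classical_set_scope.
Local Open Scope ring_scope.

(* The point (p_1, p_2, p_3) of the Heisenberg group is ((p_1, p_2), p_3), and
   a space-time point is (p, t).  Both types carry the product topology, i.e.
   the Euclidean one.  Functions defined on a subset of space-time only are
   represented by total functions whose values elsewhere are irrelevant. *)
Notation heis R := (R * R * R)%type.
Notation spacetime R := (R * R * R * R)%type.

Section Heisenberg.
Variable R : realType.
Implicit Types (p q : heis R) (z : spacetime R) (O : set (spacetime R)).

(* The group law enters below only through the vector fields X1 and X2, which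
   are left-invariant for it. *)
Definition heis_mul p q : heis R :=
  (p.1.1 + q.1.1, p.1.2 + q.1.2,
   p.2 + q.2 + 2^-1 * (p.1.1 * q.1.2 - q.1.1 * p.1.2)).

Definition koranyi_gauge p : R :=
  ((p.1.1 ^+ 2 + p.1.2 ^+ 2) ^+ 2 + 16 * p.2 ^+ 2) `^ 4^-1.

Definition gauge_ball (r : R) : set (heis R) := [set p | koranyi_gauge p < r].

Definition dir_p1 : spacetime R := (1, 0, 0, 0).
Definition dir_p2 : spacetime R := (0, 1, 0, 0).
Definition dir_p3 : spacetime R := (0, 0, 1, 0).
Definition dir_t : spacetime R := (0, 0, 0, 1).

Definition partial_dirs : set (spacetime R) :=
  [set v | [\/ v = dir_p1, v = dir_p2, v = dir_p3 | v = dir_t]].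

Fixpoint Ck_on (k : nat) O (f : spacetime R -> R) : Prop :=
  (forall z, O z -> {for z, continuous f}) /\
  if k is k'.+1 then
    forall v, partial_dirs v ->
      (forall z, O z -> derivable f z v) /\ Ck_on k' O ('D_v f)
  else True.

Definition smooth_on O (f : spacetime R -> R) : Prop := forall k, Ck_on k O f.

Definition X1 (f : spacetime R -> R) : spacetime R -> R :=
  fun z => 'D_dir_p1 f z - z.1.1.2 / 2 * 'D_dir_p3 f z.

Definition X2 (f : spacetime R -> R) : spacetime R -> R :=
  fun z => 'D_dir_p2 f z + z.1.1.1 / 2 * 'D_dir_p3 f z.

Definition X (i : 'I_2) : (spacetime R -> R) -> spacetime R -> R :=
  if i == 0 then X1 else X2.

Definition hgrad (f : spacetime R -> R) z : 'rV[R]_2 := \row_i X i f z.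

(* The diagonal entries are X1 (X1 f) z and X2 (X2 f) z. *)
Definition hhess (f : spacetime R -> R) z : 'M[R]_2 :=
  \matrix_(i, j) (2^-1 * (X i (X j f) z + X j (X i f) z)).

(* The Euclidean norm is spelled out because `|eta| is the sup norm on row
   vectors; eta^T *m eta is eta (x) eta. *)
Definition F_hmcf (eta : 'rV[R]_2) (Y : 'M[R]_2) : R :=
  - \tr ((1%:M - (\sum_i eta 0 i ^+ 2)^-1 *: (eta^T *m eta)) *m Y).

Local Open Scope ereal_scope.

Definition usc_on O (u : spacetime R -> \bar R) : Prop :=
  forall z (a : R), O z -> u z < a%:E -> \forall y \near z, O y -> u y < a%:E.

Definition lsc_on O (u : spacetime R -> \bar R) : Prop :=
  forall z (a : R), O z -> a%:E < u z -> \forall y \near z, O y -> a%:E < u y.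

Definition max_on O (u : spacetime R -> \bar R) (phi : spacetime R -> R) z :=
  [/\ O z, u z \is a fin_num &
      forall y, O y -> u y - (phi y)%:E <= u z - (phi z)%:E].

Definition min_on O (u : spacetime R -> \bar R) (phi : spacetime R -> R) z :=
  [/\ O z, u z \is a fin_num &
      forall y, O y -> u z - (phi z)%:E <= u y - (phi y)%:E].

Local Close Scope ereal_scope.

Definition subsolution O (u : spacetime R -> \bar R) : Prop :=
  [/\ usc_on O u, forall z, O z -> (u z < +oo)%E &
      forall phi z, smooth_on O phi -> max_on O u phi z ->
        (hgrad phi z != 0 ->
          'D_dir_t phi z + F_hmcf (hgrad phi z) (hhess phi z) <= 0) /\
        (hgrad phi z = 0 -> hhess phi z = 0 -> 'D_dir_t phi z <= 0)].

Definition supersolution O (u : spacetime R -> \bar R) : Prop :=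
  [/\ lsc_on O u, forall z, O z -> (-oo < u z)%E &
      forall phi z, smooth_on O phi -> min_on O u phi z ->
        (hgrad phi z != 0 ->
          0 <= 'D_dir_t phi z + F_hmcf (hgrad phi z) (hhess phi z)) /\
        (hgrad phi z = 0 -> hhess phi z = 0 -> 0 <= 'D_dir_t phi z)].

Definition solution O (u : spacetime R -> \bar R) : Prop :=
  subsolution O u /\ supersolution O u.

(* With T := Prop this is axisymmetry of a set. *)
Definition axisymmetric (T : Type) (f : heis R -> T) : Prop :=
  forall p q, q.1.1 ^+ 2 + q.1.2 ^+ 2 = p.1.1 ^+ 2 + p.1.2 ^+ 2 ->
    q.2 = p.2 -> f q = f p.

Definition initial_function (Gamma0 : set (heis R)) (u0 : heis R -> R) : Prop :=
  [/\ continuous u0,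
      axisymmetric u0,
      exists K : set (heis R), compact K /\
        exists c : R, forall p, ~ K p -> u0 p = c &
      Gamma0 = [set p | u0 p = 0]].

Definition level_set_flow (u0 : heis R -> R) (u : spacetime R -> R) : Prop :=
  [/\ {within [set z | 0 <= z.2], continuous u},
      forall t, 0 <= t -> axisymmetric (fun p => u (p, t)),
      forall p, u (p, 0) = u0 p,
      solution [set z | 0 < z.2] (fun z => (u z)%:E) &
      forall T, 0 < T -> exists K : set (heis R), compact K /\
        exists c : R, forall p t, ~ K p -> 0 <= t <= T -> u (p, t) = c].

(* The level set flow of u0 is unique, and Gamma does not depend on the choice
   of u0; neither fact is built into the definition. *)
Definition axisymmetric_evolution (Gamma : R -> set (heis R)) : Prop :=
  [/\ compact (Gamma 0), axisymmetric (Gamma 0) &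
      exists u0 u, [/\ initial_function (Gamma 0) u0, level_set_flow u0 u &
        forall t, 0 <= t -> Gamma t = [set p | u (p, t) = 0]]].

End Heisenberg.

(* Main.v *)
Require Import Defs.
From mathcomp Require Import all_boot all_order all_algebra.
From mathcomp Require Import all_classical all_reals all_analysis.
From mathcomp Require Import ring lra.
Import Order.TTheory GRing.Theory Num.Theory.
Import numFieldNormedType.Exports.
Local Open Scope classical_set_scope.
Local Open Scope ring_scope.

(* Write rho^2 = p1^2 + p2^2 and
     G(p, t) = rho^4 + 12 t rho^2 + 12 t^2 + 16 p3^2 + a p1,  a > 0.
   The symmetrized horizontal Hessian of G is (12 rho^2 + 24 t) I and its time
   derivative is 12 rho^2 + 24 t, so phi = h(G) - eps t is a strict subsolution
   wherever its horizontal gradient does not vanish, for every increasing h.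
   The gradient is nonzero where p2 = 0 and p1 >= 0, and a minimum of u - phi
   with u axisymmetric is necessarily attained at such a point because of the
   term a p1; hence the behaviour of the equation at critical points never
   enters.  At time 0, G = |p|^4 + a p1, whereas G >= 12 t^2 where p1 >= 0:
   with h(G) below u at time 0 and h positive at 12 t^2, u(., t) has no zero as
   soon as 12 t^2 > r^4.  Since test functions must touch u globally on
   t > 0 while u is not assumed bounded in time, phi is moreover lowered, after
   the time of interest, by a smooth function growing faster than u. *)

(** * Flat functions and smooth functions of arbitrarily fast growth *)

Definition flat_exp {R : realType} (n : nat) (x : R) : R :=
  if 0 < x then x^-1 ^+ n * expR (- x^-1) else 0.

Lemma flat_exp_le0 (R : realType) n (x : R) : x <= 0 -> flat_exp n x = 0.
Proof. by move=> x0; rewrite /flat_exp ltNge x0. Qed.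

Lemma flat_exp_ge0 (R : realType) n (x : R) : 0 <= flat_exp n x.
Proof.
rewrite /flat_exp; case: ifP => // x0.
by rewrite mulr_ge0 ?expR_ge0// exprn_ge0// invr_ge0 ltW.
Qed.

(** From exp(y) >= y^(n+1) / (n+1)! at y = 1/x. The bound gives continuity at 0 by squeezing. *)
Lemma flat_exp_le_linear (R : realType) n (x : R) :
  0 < x -> flat_exp n x <= n.+1`!%:R * x.
Proof.
move=> x0; rewrite /flat_exp x0 expRN.
have f0 : 0 < n.+1`!%:R :> R by rewrite ltr0n fact_gt0.
have xn0 : 0 < x^-1 ^+ n.+1 / n.+1`!%:R.
  by rewrite divr_gt0// exprn_gt0// invr_gt0.
have le_exp : x^-1 ^+ n.+1 / n.+1`!%:R <= expR x^-1.
  apply: le_trans (expR_ge1Dxn n _); first by rewrite lerDr.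
  by rewrite invr_ge0 ltW.
apply: (@le_trans _ _ (x^-1 ^+ n * (x^-1 ^+ n.+1 / n.+1`!%:R)^-1)).
  apply: ler_wpM2l; first by rewrite exprn_ge0// invr_ge0 ltW.
  by rewrite lef_pV2 ?posrE ?expR_gt0.
have : x^-1 ^+ n != 0 by rewrite gt_eqF// exprn_gt0// invr_gt0.
rewrite exprS; move: (x^-1 ^+ n) => z z0.
have -> // : z * (x^-1 * z / n.+1`!%:R)^-1 = n.+1`!%:R * x.
by field; rewrite z0 !gt_eqF.
Qed.

Lemma flat_exp_cvg0 (R : realType) n : @flat_exp R n x @[x --> 0] --> 0.
Proof.
apply: (@squeeze_cvgr _ _ _ _ (cst 0) (fun x => n.+1`!%:R * `|x|)).
- near=> x; rewrite flat_exp_ge0 /=.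
  have [x0|x0] := leP x 0; first by rewrite flat_exp_le0// mulr_ge0.
  by rewrite gtr0_norm// flat_exp_le_linear.
- exact: cvg_cst.
- have /= : (fun x : R => n.+1`!%:R * `|x|) x @[x --> 0] --> n.+1`!%:R * `|0 : R|.
    by apply: cvgM; [exact: cvg_cst|apply: cvg_norm; exact: cvg_id].
  by rewrite normr0 mulr0.
Unshelve. all: by end_near. Qed.

(** Differentiating x^-n exp(-1/x) only raises n, so the family is closed under differentiation up
    to linear combinations, and each member is smooth. *)
Lemma is_derive_flat_exp (R : realType) n (x : R) :
  is_derive x 1 (flat_exp n)
    (- n%:R * flat_exp n.+1 x + flat_exp n.+2 x).
Proof.
have [x0|x0|->] := ltgtP x 0.
- rewrite !flat_exp_le0 ?(ltW x0)// mulr0 addr0.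
  apply: (@near_eq_is_derive _ _ _ (cst 0)).
  near=> y; rewrite flat_exp_le0//= ltW//.
  by near: y; exact: lt_nbhsl.
- pose f : R -> R := (fun y => y^-1) ^+ n * (expR \o (fun y => - y^-1)).
  suff df : is_derive x 1 f (- n%:R * flat_exp n.+1 x + flat_exp n.+2 x).
    apply: near_eq_is_derive df; near=> y.
    rewrite /flat_exp ifT; last by near: y; exact: lt_nbhsr.
    by rewrite /f mulrfctE exprfctE.
  have xn0 : x != 0 by rewrite gt_eqF.
  have dV : is_derive x 1 (fun y : R => y^-1) (- x ^- 2 *: 1).
    exact: (@is_deriveV _ id).
  have dE : is_derive x 1 (expR \o (fun y : R => - y^-1))
      (expR (- x^-1) * - (- x ^- 2 *: 1)).
    by apply: is_derive1_comp; exact: is_deriveN.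
  apply: is_derive_eq.
  rewrite /flat_exp x0 exprfctE /= /GRing.scale /=.
  case: n {f} => [|n] /=; first by field.
  have -> : x ^- 2 = x^-1 * x^-1 by rewrite expr2 invfM.
  by rewrite !exprS; ring.
- rewrite !flat_exp_le0// mulr0 addr0.
  (* At 0 the difference quotient of [flat_exp n] is [flat_exp n.+1], which tends to 0. *)
  have quot : (fun h : R => h^-1 *: ((flat_exp n \o shift 0) (h *: 1)
      - flat_exp n 0)) @ 0^' --> 0.
    have -> : (fun h : R => h^-1 *: ((flat_exp n \o shift 0) (h *: 1)
        - flat_exp n 0)) = flat_exp n.+1.
      apply/funext => h; rewrite /= addr0 (flat_exp_le0 _ _ 0)// subr0.
      rewrite /GRing.scale /= mulr1 /flat_exp.
      by case: ifP => _; rewrite ?mulr0// mulrA exprS.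
    by apply: cvg_within_filter; exact: flat_exp_cvg0.
  by apply: DeriveDef; [apply/cvg_ex; exists 0|exact: cvg_lim].
Unshelve. all: by end_near. Qed.

(* The terms with k >= t vanish, so that the truncated sum is the full series. *)
Definition flat_sum {R : realType} (c : nat -> R) (n : nat) (t : R) : R :=
  \sum_(0 <= k < (Num.truncn t).+1) c k * flat_exp n (t - k%:R).

(** One cut-off thus serves a whole neighbourhood of a given time, where the sum can be
    differentiated term by term. *)
Lemma flat_sumE (R : realType) (c : nat -> R) n m (t : R) : t <= m%:R ->
  flat_sum c n t = \sum_(0 <= k < m) c k * flat_exp n (t - k%:R).
Proof.
have tail m1 m2 : (m1 <= m2)%N -> t <= m1%:R ->
    \sum_(0 <= k < m2) c k * flat_exp n (t - k%:R) =
    \sum_(0 <= k < m1) c k * flat_exp n (t - k%:R).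
  move=> m12 tm1.
  rewrite (big_cat_nat _ m12)//= [X in _ + X]big_nat [X in _ + X]big1 ?addr0//.
  move=> k /andP[m1k _]; rewrite flat_exp_le0 ?mulr0// subr_le0.
  by rewrite (le_trans tm1)// ler_nat.
move=> tm; rewrite /flat_sum; set m0 := (Num.truncn t).+1.
have tm0 : t <= m0%:R by rewrite ltW// truncnS_gt.
by have [?|/ltnW ?] := leqP m0 m; [rewrite -(tail m0 m)|rewrite (tail m m0)].
Qed.

Lemma is_derive_flat_sum (R : realType) (c : nat -> R) n (t : R) :
  is_derive t 1 (flat_sum c n)
    (- n%:R * flat_sum c n.+1 t + flat_sum c n.+2 t).
Proof.
set m := (Num.truncn t).+1.
have tm : t < m%:R by exact: truncnS_gt.
pose f (k : 'I_m) (x : R) := c k * flat_exp n (x - k%:R).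
have df k : is_derive t 1 (f k) (c k * (- n%:R * flat_exp n.+1 (t - k%:R)
    + flat_exp n.+2 (t - k%:R))).
  have dc : is_derive t 1 (flat_exp n \o (fun x => x - k%:R))
      ((- n%:R * flat_exp n.+1 (t - k%:R) + flat_exp n.+2 (t - k%:R)) * 1).
    by apply: is_derive1_comp; [exact: is_derive_flat_exp|exact: is_derive_shift].
  have := is_deriveZ (c k) dc.
  by rewrite mulr1.
have := is_derive_sum df.
have -> : \sum_(k < m) c k * (- n%:R * flat_exp n.+1 (t - k%:R)
    + flat_exp n.+2 (t - k%:R)) = - n%:R * flat_sum c n.+1 t + flat_sum c n.+2 t.
  rewrite /flat_sum -/m !big_mkord mulr_sumr -big_split/=.
  by apply: eq_bigr => k _; ring.
apply: near_eq_is_derive; near=> x.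
rewrite (@flat_sumE _ _ _ m) ?fct_sumE ?big_mkord//.
by apply: ltW; near: x; exact: lt_nbhsl.
Unshelve. all: by end_near. Qed.

Lemma smooth_fast_growth (R : realType) (b : nat -> R) (N : nat) :
  exists s : nat -> R -> R,
    [/\ forall n (t : R), is_derive t 1 (s n) (- n%:R * s n.+1 t + s n.+2 t),
        forall n (t : R), 0 <= s n t,
        forall n (t : R), t <= N%:R -> s n t = 0 &
        forall k (t : R), (N <= k)%N -> k.+1%:R <= t -> b k <= s 0%N t].
Proof.
(* Since [flat_exp 0] is at least exp(-1) from 1 on, the factor exp(1) lets the k-th term alone
   reach [b k] once t >= k+1. Dropping k < N keeps the sum zero up to time N. *)
pose c k : R := if (k < N)%N then 0 else Num.max 0 (b k) * expR 1.
have c0 k : 0 <= c k.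
  by rewrite /c; case: ifP => // _; rewrite mulr_ge0 ?expR_ge0// le_max lexx.
exists (flat_sum c); split.
- by move=> n t; exact: is_derive_flat_sum.
- by move=> n t; apply: sumr_ge0 => k _; rewrite mulr_ge0// flat_exp_ge0.
- move=> n t tN; rewrite (flat_sumE _ _ _ _ _ tN) big_nat big1// => k /andP[_ kN].
  by rewrite /c kN mul0r.
- move=> k t Nk kt; rewrite /flat_sum big_mkord.
  have kt' : (k < (Num.truncn t).+1)%N.
    rewrite ltnS truncn_ge_nat; last by rewrite (le_trans _ kt).
    by rewrite (le_trans _ kt)// ler_nat.
  rewrite (bigD1 (Ordinal kt'))//= -[b k]addr0 lerD//; last first.
    by apply: sumr_ge0 => i _; rewrite mulr_ge0// flat_exp_ge0.
  have tk1 : 1 <= t - k%:R by rewrite lerBrDl natr1.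
  have tk0 : 0 < t - k%:R by exact: lt_le_trans tk1.
  rewrite /flat_exp tk0 expr0 mul1r /c ltnNge Nk/= -mulrA -expRD.
  apply: (@le_trans _ _ (Num.max 0 (b k))); first by rewrite le_max lexx orbT.
  rewrite ler_peMr ?le_max ?lexx// -[leLHS]expR0 ler_expR.
  by rewrite subr_ge0 invf_le1.
Qed.

(** * Symbolic calculus of functions on space-time *)

Inductive dir : Type := Dir1 | Dir2 | Dir3 | DirT.

Definition dir_vec {R : realType} (v : dir) : spacetime R :=
  match v with
  | Dir1 => dir_p1 R | Dir2 => dir_p2 R | Dir3 => dir_p3 R | DirT => dir_t R
  end.

Definition coord {R : realType} (v : dir) (z : spacetime R) : R :=
  match v with
  | Dir1 => z.1.1.1 | Dir2 => z.1.1.2 | Dir3 => z.1.2 | DirT => z.2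
  end.

(* Symbolic functions of space-time: smoothness and iterated derivatives are
   read off the syntax.  TimeFun n stands for s n t, where the family s satisfies
   (s n)' = - n s (n+1) + s (n+2), as x^-n exp(-1/x) does. *)
Inductive expr (R : realType) : Type :=
  | Const of R
  | Coord of dir
  | TimeFun of nat
  | Exp of expr R
  | Add of expr R & expr R
  | Mul of expr R & expr R.

Arguments Const {R}.
Arguments Coord {R}.
Arguments TimeFun {R}.
Arguments Exp {R}.
Arguments Add {R}.
Arguments Mul {R}.

Fixpoint eval {R : realType} (s : nat -> R -> R) (e : expr R)
    (z : spacetime R) : R :=
  match e with
  | Const c => c
  | Coord v => coord v z
  | TimeFun n => s n z.2
  | Exp e1 => expR (eval s e1 z)
  | Add e1 e2 => eval s e1 z + eval s e2 z
  | Mul e1 e2 => eval s e1 z * eval s e2 z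
  end.

Definition same_dir (v w : dir) : bool :=
  match v, w with
  | Dir1, Dir1 | Dir2, Dir2 | Dir3, Dir3 | DirT, DirT => true
  | _, _ => false
  end.

Fixpoint diff_expr {R : realType} (v : dir) (e : expr R) : expr R :=
  match e with
  | Const _ => Const 0
  | Coord w => Const (same_dir v w)%:R
  | TimeFun n =>
      if same_dir v DirT
      then Add (Mul (Const (- n%:R)) (TimeFun n.+1)) (TimeFun n.+2)
      else Const 0
  | Exp e1 => Mul (Exp e1) (diff_expr v e1)
  | Add e1 e2 => Add (diff_expr v e1) (diff_expr v e2)
  | Mul e1 e2 =>
      Add (Mul (diff_expr v e1) e2) (Mul e1 (diff_expr v e2))
  end.

Lemma is_derive_line (R : realType) (f : spacetime R -> R) z v (d : R) :
  is_derive (0 : R) 1 (fun h => f (h *: v + z)) d -> is_derive z v f d.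
Proof.
have quot : (fun h : R => h^-1 *: ((f \o shift z) (h *: v) - f z)) =
    (fun h : R => h^-1 *: (((fun h : R => f (h *: v + z)) \o shift 0)
      (h *: (1 : R)) - f (0 *: v + z))).
  apply/funext => h /=; rewrite scale0r add0r addr0.
  by rewrite /GRing.scale /= mulr1.
by move=> [] dv eqd; split; [move: dv|move: eqd];
   rewrite /derivable /derive quot.
Qed.

Lemma coord_line (R : realType) (v w : dir) (z : spacetime R) (h : R) :
  coord w (h *: dir_vec v + z) = h * (same_dir v w)%:R + coord w z.
Proof.
by case: v; case: w; rewrite /= /GRing.scale /= ?mulr1 ?mulr0.
Qed.

Lemma continuous_fst (T U : topologicalType) : continuous (@fst T U).
Proof. by move=> [x y]; exact: cvg_fst. Qed.

Lemma continuous_snd (T U : topologicalType) : continuous (@snd T U).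
Proof. by move=> [x y]; exact: cvg_snd. Qed.

Lemma continuous_coord (R : realType) (w : dir) :
  continuous (@coord R w).
Proof.
case: w => z.
- apply: (@continuous_comp _ _ _ (fun z : spacetime R => z.1.1) fst);
    last exact: continuous_fst.
  apply: (@continuous_comp _ _ _ (fun z : spacetime R => z.1) fst); exact: continuous_fst.
- apply: (@continuous_comp _ _ _ (fun z : spacetime R => z.1.1) snd);
    last exact: continuous_snd.
  apply: (@continuous_comp _ _ _ (fun z : spacetime R => z.1) fst); exact: continuous_fst.
- apply: (@continuous_comp _ _ _ (fun z : spacetime R => z.1) snd);
    last exact: continuous_snd.
  exact: continuous_fst.
- exact: continuous_snd.
Qed.

Section Eval.
Variables (R : realType) (s : nat -> R -> R).
Hypothesis ds : forall n (t : R),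
  is_derive t 1 (s n) (- n%:R * s n.+1 t + s n.+2 t).

Lemma is_derive_eval (v : dir) (e : expr R) (z : spacetime R) :
  is_derive z (dir_vec v) (eval s e) (eval s (diff_expr v e) z).
Proof.
apply: is_derive_line.
have dcoord w : is_derive (0 : R) 1 (fun h => coord w (h *: dir_vec v + z))
    (same_dir v w)%:R.
  have -> : (fun h : R => coord w (h *: dir_vec v + z)) =
      ((same_dir v w)%:R \*: id) + cst (coord w z).
    by apply/funext => h; rewrite coord_line /= mulrC.
  by apply: is_derive_eq; rewrite addr0 /GRing.scale /= mulr1.
elim: e => [c|w|n|e IH|e1 IH1 e2 IH2|e1 IH1 e2 IH2].
- exact: is_derive_cst.
- exact: dcoord.
- have := @is_derive1_comp R (s n) (fun h => coord DirT (h *: dir_vec v + z))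
    0 _ _ (ds _ _) (dcoord DirT).
  rewrite scale0r add0r => /is_derive_eq; apply.
  by case: v {dcoord} => /=; rewrite ?mulr0 ?mulr1.
- have := @is_derive1_comp R expR (fun h => eval s e (h *: dir_vec v + z))
    0 _ _ (is_derive_expR _) IH.
  by rewrite scale0r add0r.
- exact: is_deriveD.
- have := is_deriveM IH1 IH2.
  move=> /is_derive_eq; apply; rewrite scale0r add0r /GRing.scale /=.
  by rewrite addrC mulrC.
Qed.

Lemma derive_eval (v : dir) (e : expr R) :
  'D_(dir_vec v) (eval s e) = eval s (diff_expr v e).
Proof. by apply/funext => z; have [] := is_derive_eval v e z. Qed.

Lemma continuous_eval (e : expr R) : continuous (eval s e).
Proof.
elim: e => [c|w|n|e IH|e1 IH1 e2 IH2|e1 IH1 e2 IH2] z.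
- exact: cvg_cst.
- exact: continuous_coord.
- apply: (@continuous_comp _ _ _ (coord DirT) (s n)).
    exact: continuous_coord.
  apply: differentiable_continuous; apply/derivable1_diffP.
  exact: (@ex_derive _ _ _ _ _ _ _ (ds n z.2)).
- by apply: (@cvg_comp _ _ _ (eval s e) expR); [exact: IH|exact: continuous_expR].
- by apply: cvgD; [exact: IH1|exact: IH2].
- by apply: cvgM; [exact: IH1|exact: IH2].
Qed.

(** Each partial derivative is again the value of an expression, and all of these are continuous. *)
Lemma smooth_eval (O : set (spacetime R)) (e : expr R) :
  smooth_on O (eval s e).
Proof.
move=> k; elim: k e => [|k IH] e.
  by split=> // z _; exact: continuous_eval.
split; first by move=> z _; exact: continuous_eval.
move=> v dv; have [w ->] : exists w, v = dir_vec w.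
  by case: dv => ->; [exists Dir1|exists Dir2|exists Dir3|exists DirT].
split; first by move=> z _; have [] := is_derive_eval w e z.
by rewrite derive_eval; exact: IH.
Qed.

End Eval.

(** * The mean curvature operator on the barrier *)

(** In dimension two the projection orthogonal to [eta] has trace 1, and it annihilates the tensor
    square of [eta]. *)
Lemma F_hmcf_isotropic (R : realType) (eta : 'rV[R]_2) (Y : 'M[R]_2) (m mu : R) :
  eta != 0 -> (forall i j, Y i j = m * (i == j)%:R + mu * (eta 0 i * eta 0 j)) ->
  F_hmcf eta Y = - m.
Proof.
move=> eta0 YE.
have sq0 : eta 0 0 ^+ 2 + eta 0 1 ^+ 2 != 0.
  apply: contra eta0; rewrite paddr_eq0 ?sqr_ge0// !sqrf_eq0 => /andP[/eqP e0 /eqP e1].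
  apply/eqP/rowP => i; rewrite mxE.
  case: (unliftP ord0 i) => [j ->|-> //]; rewrite -[RHS]e1; congr (eta 0 _).
  by apply/val_inj; rewrite /= ord1.
rewrite /F_hmcf /mxtrace !big_ord_recl !big_ord0 !mxE !big_ord_recl !big_ord0 !mxE.
rewrite !big_ord_recl !big_ord0 !mxE !YE /=.
have -> : lift ord0 ord0 = 1 :> 'I_2 by exact/val_inj.
have -> : ord0 = 0 :> 'I_2 by exact/val_inj.
rewrite /= ?mulr1n ?mulr0n.
by field.
Qed.

(** The function G of the overview, at z = (p, t). *)
Definition level {R : realType} (a : R) (z : spacetime R) : R :=
  (z.1.1.1 ^+ 2 + z.1.1.2 ^+ 2) ^+ 2 + 12 * z.2 * (z.1.1.1 ^+ 2 + z.1.1.2 ^+ 2)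
  + 12 * z.2 ^+ 2 + 16 * z.1.2 ^+ 2 + a * z.1.1.1.

Section Barrier.
Variables (R : realType) (s : nat -> R -> R).
Hypothesis ds : forall n (t : R),
  is_derive t 1 (s n) (- n%:R * s n.+1 t + s n.+2 t).

Definition X_expr (i : 'I_2) (e : expr R) : expr R :=
  if i == 0
  then Add (diff_expr Dir1 e)
         (Mul (Mul (Const (- 2^-1)) (Coord Dir2)) (diff_expr Dir3 e))
  else Add (diff_expr Dir2 e)
         (Mul (Mul (Const 2^-1) (Coord Dir1)) (diff_expr Dir3 e)).

Lemma X_eval (i : 'I_2) (e : expr R) : X i (eval s e) = eval s (X_expr i e).
Proof.
have d v z : 'D_(dir_vec v) (eval s e) z = eval s (diff_expr v e) z.
  by rewrite -(derive_eval _ _ ds).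
have /= d1 := d Dir1; have /= d2 := d Dir2; have /= d3 := d Dir3.
rewrite /X /X_expr; case: ifP => _; apply/funext => z.
- by rewrite /X1 d1 d3 /=; ring.
- by rewrite /X2 d2 d3 /=; ring.
Qed.

Definition radius2 : expr R :=
  Add (Mul (Coord Dir1) (Coord Dir1)) (Mul (Coord Dir2) (Coord Dir2)).

Definition level_expr (a : R) : expr R :=
  Add (Mul radius2 radius2)
 (Add (Mul (Mul (Const 12) (Coord DirT)) radius2)
 (Add (Mul (Const 12) (Mul (Coord DirT) (Coord DirT)))
 (Add (Mul (Const 16) (Mul (Coord Dir3) (Coord Dir3)))
      (Mul (Const a) (Coord Dir1))))).

(* The factor sg = 1 or -1 turns the barrier for - u into a test function for u. *)
Definition barrier_expr (sg a al be k eps : R) : expr R :=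
  Mul (Const sg)
    (Add (Add (Const al) (Mul (Const be) (Exp (Mul (Const k) (level_expr a)))))
         (Mul (Const (-1)) (Add (Mul (Const eps) (Coord DirT)) (TimeFun 0)))).

Lemma eval_level (a : R) z : eval s (level_expr a) z = level a z.
Proof. by rewrite /level /=; ring. Qed.

Lemma eval_barrier (sg a al be k eps : R) z :
  eval s (barrier_expr sg a al be k eps) z =
  sg * (al + be * expR (k * level a z) - (eps * z.2 + s 0%N z.2)).
Proof. by rewrite -eval_level /= mulN1r. Qed.

Variables (sg a al be k eps : R) (z : spacetime R).
Hypotheses (sg0 : sg != 0) (be0 : be != 0) (k0 : k != 0) (a0 : 0 < a)
  (z10 : 0 <= z.1.1.1) (z20 : z.1.1.2 = 0) (t0 : 0 <= z.2).

Let phi := barrier_expr sg a al be k eps.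
(** With h(x) = al + be exp(k x), [lam] is the derivative of sg h at G. Below, [m] is both the time
    derivative of G and the factor of its isotropic Hessian. *)
Let lam : R := sg * be * k * expR (k * eval s (level_expr a) z).
Let m : R := 12 * (z.1.1.1 ^+ 2 + z.1.1.2 ^+ 2) + 24 * z.2.

Let w (i : 'I_2) : R := eval s (X_expr i (level_expr a)) z.

Let X_phi i : eval s (X_expr i phi) z = lam * w i.
Proof.
by rewrite /lam /w /X_expr; case: ifP => _; rewrite /=; move: (expR _) => E; ring.
Qed.

(* The term with k is a multiple of the square of the gradient, which F kills. *)
Let XX_phi i j : 2^-1 * (eval s (X_expr i (X_expr j phi)) z
    + eval s (X_expr j (X_expr i phi)) z) =
  lam * m * (i == j)%:R + (lam * k) * (w i * w j).
Proof.
rewrite /lam /w /m.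
have -> : (i == j) = ((i == 0) == (j == 0)).
  by case: i j => [[|[|i]] ?] [[|[|j]] ?].
rewrite /X_expr; case: (i == 0); case: (j == 0); rewrite /=;
  move: (expR _) => E; move: z.1.1.1 z.1.1.2 z.1.2 z.2 => x y q t; by field.
Qed.

(** At p2 = 0 the X1 derivative of G is 4 p1^3 + 24 t p1 + a, positive for p1, t >= 0, and [lam] is
    nonzero. *)
Lemma barrier_hgrad_neq0 : hgrad (eval s phi) z != 0.
Proof.
apply/eqP => /rowP /(_ 0); rewrite !mxE X_eval X_phi => /eqP.
rewrite !mulf_eq0 (negPf sg0) (negPf be0) (negPf k0) gt_eqF ?expR_gt0//=.
rewrite /w /X_expr eqxx /= z20.
set W := (X in X == 0); have -> : W = 4 * z.1.1.1 ^+ 3 + 24 * (z.2 * z.1.1.1) + a.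
  by rewrite /W; ring.
rewrite gt_eqF// ltr_wpDl// addr_ge0// !mulr_ge0//.
Qed.

(** The time derivative [lam m] of sg h(G) cancels against the curvature term. Only the part
    depending on time alone is left, and (s 0)' = s 2. *)
Lemma barrier_operator :
  'D_(dir_t R) (eval s phi) z + F_hmcf (hgrad (eval s phi) z) (hhess (eval s phi) z)
  = - (sg * (eps + s 2 z.2)).
Proof.
(* The gradient is [lam w] and the rank-one part of the Hessian is [lam k] times the tensor square
   of [w], whence [k / lam]. *)
rewrite (@F_hmcf_isotropic _ _ _ (lam * m) (k / lam)) ?barrier_hgrad_neq0//; last first.
  move=> i j; rewrite !mxE !X_eval XX_phi !X_phi; congr (_ + _).
  have : lam != 0 by rewrite !mulf_neq0// gt_eqF ?expR_gt0.
  by move=> l0; field.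
have /= -> := f_equal (@^~ z) (derive_eval _ _ ds DirT phi).
rewrite /lam /m; move: (expR _); rewrite /=.
move=> E; ring.
Qed.

End Barrier.

Arguments radius2 {R}.
Arguments level_expr {R}.
Arguments barrier_expr {R}.

(** * Compactness and the Koranyi gauge *)

Section Compactness.
Variables (R : realType) (T : topologicalType) (f : T -> R) (A : set T).
Hypotheses (cA : compact A) (cf : {within A, continuous f}).

Lemma compact_lbound : exists b, forall x, A x -> b <= f x.
Proof.
have [->|/set0P A0] := eqVneq A set0; first by exists 0.
have [x _ xmin] := compact_EVT_min A0 cA cf.
by exists (f x) => y Ay; apply: xmin; rewrite inE.
Qed.

Lemma compact_pos_lbound : (forall x, A x -> 0 < f x) ->
  exists2 b, 0 < b & forall x, A x -> b <= f x.
Proof.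
move=> f0; have [->|/set0P A0] := eqVneq A set0; first by exists 1.
have [x xA xmin] := compact_EVT_min A0 cA cf; rewrite inE in xA.
by exists (f x); [exact: f0|move=> y Ay; apply: xmin; rewrite inE].
Qed.

End Compactness.

(** The fourth power of the Koranyi gauge, a polynomial. It is also G at time 0 without the term a
    p1. *)
Definition gauge4 {R : realType} (p : heis R) : R :=
  (p.1.1 ^+ 2 + p.1.2 ^+ 2) ^+ 2 + 16 * p.2 ^+ 2.

Lemma gauge4_ge0 (R : realType) (p : heis R) : 0 <= gauge4 p.
Proof. by rewrite /gauge4 addr_ge0 ?sqr_ge0// mulr_ge0// sqr_ge0. Qed.

Lemma gauge_ball_gauge4 (R : realType) (r : R) (p : heis R) :
  0 < r -> gauge_ball r p -> gauge4 p < r ^+ 4.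
Proof.
move=> r0; rewrite /gauge_ball /= /koranyi_gauge -/(gauge4 p) => pr.
have [//|rp] := ltP (gauge4 p) (r ^+ 4).
suff rle : r <= gauge4 p `^ 4^-1 by have := le_lt_trans rle pr; rewrite ltxx.
have {1}-> : r = (r ^+ 4) `^ 4^-1.
  by rewrite -powR_mulrn ?(ltW r0)// -powRrM mulfV ?pnatr_eq0// powRr1// ltW.
apply: ge0_ler_powR => //; rewrite ?invr_ge0 ?nnegrE ?gauge4_ge0//.
by rewrite exprn_ge0// ltW.
Qed.

Lemma continuous_gauge4 (R : realType) : continuous (@gauge4 R).
Proof.
move=> p.
have c1 : {for p, continuous (fun q : heis R => q.1.1)}.
  by apply: (@continuous_comp _ _ _ fst fst); exact: continuous_fst.
have c2 : {for p, continuous (fun q : heis R => q.1.2)}.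
  by apply: (@continuous_comp _ _ _ fst snd); [exact: continuous_fst|exact: continuous_snd].
have c3 : {for p, continuous (fun q : heis R => q.2)} by exact: continuous_snd.
have sq (f : heis R -> R) : {for p, continuous f} ->
    {for p, continuous (fun q => f q ^+ 2)} by move=> cf; exact: (cvgM cf cf).
rewrite /gauge4; apply: cvgD.
  by apply: (sq _ _); apply: cvgD; [exact: (sq _ c1)|exact: (sq _ c2)].
by apply: cvgM; [exact: cvg_cst|exact: (sq _ c3)].
Qed.

Lemma compact_gauge4_ubound (R : realType) (K : set (heis R)) :
  compact K -> exists B, forall p, K p -> gauge4 p <= B.
Proof.
move=> cK; have [|b bK] := @compact_lbound R _ (fun p => - gauge4 p) K cK.
  apply: continuous_subspaceT => p; apply: cvgN; exact: continuous_gauge4.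
by exists (- b) => p /bK; rewrite lerNr.
Qed.

(** Far points of the vertical axis leave every compact set; such points serve to read off constant
    values at infinity. *)
Lemma compact_escape (R : realType) (K : set (heis R)) (B : R) :
  compact K -> exists2 p, ~ K p & B <= gauge4 p.
Proof.
move=> /compact_gauge4_ubound [B' KB'].
pose x : R := 1 + `|B| + `|B'|.
have xE : gauge4 (0, 0, x) = 16 * x ^+ 2 by rewrite /gauge4 /=; ring.
have [B0 B'0] := (normr_ge0 B, normr_ge0 B').
have [leB leB'] := (ler_norm B, ler_norm B').
have x1 : 1 <= x by rewrite /x; lra.
have xx : x <= x ^+ 2 by rewrite ler_eXnr.
have Bx : B + B' < 16 * x ^+ 2 /\ B <= 16 * x ^+ 2 /\ B' < 16 * x ^+ 2.
  by move: xx; rewrite {1}/x; lra.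
exists (0, 0, x); last by rewrite xE; case: Bx => _ [].
by move=> /KB'; rewrite xE leNgt; case: Bx => _ [_ ->].
Qed.

(** The scaling is the Euclidean one: the two terms gain factors l^4 and l^2, both at least l. *)
Lemma gauge4_dilate (R : realType) (p : heis R) (l : R) :
  1 <= l -> l * gauge4 p <= gauge4 (l *: p).
Proof.
move=> l1; have -> : gauge4 (l *: p) =
    l ^+ 4 * (p.1.1 ^+ 2 + p.1.2 ^+ 2) ^+ 2 + l ^+ 2 * (16 * p.2 ^+ 2).
  by rewrite /gauge4 /= /GRing.scale /=; ring.
rewrite mulrDr lerD// ler_wpM2r ?sqr_ge0// ?ler_eXnr//.
by rewrite mulr_ge0// sqr_ge0.
Qed.

(* Along the rays from the origin the gauge increases, so by the intermediate
   value theorem v keeps the sign it has at infinity. *)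
Lemma initial_lbound (R : realType) (v : heis R -> R) (K : set (heis R)) (c r4 : R) :
  continuous v -> compact K -> (forall p, ~ K p -> v p = c) -> 0 < c -> 0 < r4 ->
  (forall p, v p = 0 -> gauge4 p < r4) ->
  exists d M : R, [/\ 0 < d, d <= c, 0 <= M, forall p, - M <= v p &
    forall p, r4 <= gauge4 p -> d <= v p].
Proof.
move=> cv cK vc c0 r40 v0.
have [B KB] := compact_gauge4_ubound _ _ cK.
have pos p : r4 <= gauge4 p -> 0 < v p.
  move=> pr; have [//|vp0] := ltP 0 (v p).
  have p0 : 0 < gauge4 p by exact: lt_le_trans pr.
  (* Here [l * gauge4 p] exceeds [B], so [l *: p] lies outside [K]. *)
  pose l := 1 + `|B| / gauge4 p.
  have l1 : 1 <= l by rewrite lerDl divr_ge0 ?normr_ge0 ?ltW.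
  have vl : v (l *: p) = c.
    apply: vc => /KB; apply/negP; rewrite -ltNge.
    apply: lt_le_trans (gauge4_dilate _ p _ l1).
    rewrite /l mulrDl mul1r divfK ?gt_eqF//.
    by rewrite ltr_pwDl// ler_norm.
  have [||x] := @IVT R (fun x => v (x *: p)) 1 l 0 l1.
  - apply: continuous_subspaceT => x.
    apply: (@continuous_comp _ _ _ (fun x : R => x *: p) v); last exact: cv.
    exact: scalel_continuous.
  - by rewrite scale1r vl ge_min vp0/= le_max (ltW c0) orbT.
  rewrite /= in_itv/= => /andP[x1 _] /v0.
  rewrite ltNge (le_trans pr)// (le_trans _ (gauge4_dilate _ p _ x1))//.
  by rewrite ler_peMl ?gauge4_ge0.
have [b bK] : exists b, forall p, K p -> b <= v p.
  by apply: compact_lbound => //; exact: continuous_subspaceT.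
have [d d0 dK] : exists2 d, 0 < d &
    forall p, (K `&` [set p | r4 <= gauge4 p]) p -> d <= v p.
  apply: compact_pos_lbound; last by move=> p [_ /pos].
  - apply: compact_closedI => //.
    apply: (closed_comp (f := @gauge4 R) (D := [set x | r4 <= x])).
      by move=> p _; exact: continuous_gauge4.
    exact: closed_ge.
  - exact: continuous_subspaceT.
exists (Num.min d c), `|b|; split => //.
- by rewrite lt_min d0.
- by rewrite ge_min lexx orbT.
- move=> p; have [Kp|/vc ->] := pselect (K p).
    by rewrite (le_trans _ (bK _ Kp))// lerNl -normrN ler_norm.
  by rewrite (le_trans _ (ltW c0))// oppr_le0.
- move=> p rp; rewrite ge_min; have [Kp|/vc ->] := pselect (K p).
    by rewrite dK.
  by rewrite lexx orbT.
Qed.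

(** * Comparison of the flow with the barrier *)

Section Comparison.
Variables (R : realType) (u0 : heis R -> R) (u : spacetime R -> R) (c sg : R).
Hypotheses (flow : level_set_flow u0 u) (sgE : sg = 1 \/ sg = -1)
  (u_far : forall T, 0 < T -> exists2 K : set (heis R), compact K &
     forall p t, ~ K p -> 0 <= t <= T -> u (p, t) = c).

Let within_slab (K : set (heis R)) (T : R) (f : spacetime R -> R) :
  continuous f ->
  {within K `*` `[0, T], continuous (fun z => sg * u z - f z)}.
Proof.
move=> cf; have [cu _ _ _ _] := flow.
have {}cu : {within K `*` `[0, T], continuous u}.
  by apply: continuous_subspaceW cu => -[p t] [_]; rewrite /= in_itv/= => /andP[].
move=> z; apply: cvgB; last exact: (continuous_subspaceT cf).
by apply: cvgM; [exact: cvg_cst|exact: cu].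
Qed.

Lemma slab_compact (K : set (heis R)) (T : R) :
  compact K -> compact (K `*` `[0, T]).
Proof. by move=> cK; apply: compact_setX => //; exact: segment_compact. Qed.

Lemma flow_lbound (T : R) : 0 < T ->
  exists b, forall p t, 0 <= t <= T -> b <= sg * u (p, t).
Proof.
move=> T0; have [K cK uK] := u_far _ T0.
have [b bK] := compact_lbound _ _ _ _ (slab_compact _ T cK)
  (within_slab K T (cst 0) (@cst_continuous _ _ 0)).
exists (Num.min b (sg * c)) => p t tT; rewrite ge_min.
have [Kp|/uK ->//] := pselect (K p); last by rewrite lexx orbT.
by have := bK (p, t); rewrite /= subr0 => -> //; split => //=; rewrite in_itv.
Qed.

(* A minimum of sg u - phi is a minimum of u - phi or of - u - phi according to
   the sign sg, so it is tested with the test function sg phi. *)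
Lemma flow_touching (phi sphi : spacetime R -> R) z :
  smooth_on [set z | 0 < z.2] sphi -> (forall y, sphi y = sg * phi y) ->
  0 < z.2 -> (forall y, 0 < y.2 -> sg * u z - phi z <= sg * u y - phi y) ->
  hgrad sphi z != 0 ->
  0 <= sg * ('D_(dir_t R) sphi z + F_hmcf (hgrad sphi z) (hhess sphi z)).
Proof.
have [_ _ _ [[_ _ sub] [_ _ sup]] _] := flow.
move=> smooth sphiE z0 zmin grad0; case: sgE zmin sphiE => -> zmin sphiE.
- rewrite mul1r; have [] := sup _ z smooth; last by move=> /(_ grad0).
  split => // y y0; rewrite -!EFinB lee_fin !sphiE !mul1r.
  by have := zmin _ y0; rewrite !mul1r.
- rewrite mulN1r oppr_ge0; have [] := sub _ z smooth; last by move=> /(_ grad0).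
  split => // y y0; rewrite -!EFinB lee_fin !sphiE !mulN1r !opprK.
  by have := zmin _ y0; rewrite !mulN1r; lra.
Qed.

(** As be and k are negative, h(x) = d + be exp(k x) is increasing and at most d. If the bound
    fails, [sg u - phi] has a negative minimum over a compact slab, hence over all positive times,
    and the equation there forces eps + s 2 <= 0. *)
Lemma barrier_le (a d be k eps : R) (N : nat) :
  0 < a -> be < 0 -> k < 0 -> 0 < eps -> d <= sg * c ->
  (forall p, d + be * expR (k * (gauge4 p + a * p.1.1)) <= sg * u0 p) ->
  forall p t, 0 <= t <= N%:R ->
    d + be * expR (k * level a (p, t)) - eps * t
      <= sg * u (p, t).
Proof.
move=> a0 be0 k0 eps0 dc le0 p1 t1 /andP[t10 t1N].
have sg2 : sg * sg = 1 by case: sgE => ->; rewrite ?mulr1 ?mulrNN ?mulr1.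
have sg0 : sg != 0 by case: sgE => ->; rewrite ?oppr_eq0 oner_eq0.
have /boolp.choice [lb lbP] (n : nat) :
    exists b, forall p t, 0 <= t <= n.+2%:R -> b <= sg * u (p, t).
  by have [|b bP] := flow_lbound n.+2%:R; [rewrite ltr0n|exists b].
(* For n >= N and t in [n+1, n+2] this gives phi <= d - s 0 t <= lb n <= sg u, while [s 0] vanishes
   up to time N. *)
have [s [ds s0 sN sgrow]] := smooth_fast_growth R (fun n => d - lb n) N.
pose phi := eval s (barrier_expr 1 a d be k eps).
pose sphi := eval s (barrier_expr sg a d be k eps).
have phiE z : phi z = d + be * expR (k * level a z)
    - (eps * z.2 + s 0%N z.2) by rewrite /phi eval_barrier mul1r.
have phi_le z : 0 <= z.2 -> phi z <= d - s 0%N z.2.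
  move=> z0; rewrite phiE.
  have : be * expR (k * level a z) <= 0.
    by rewrite mulr_le0_ge0 ?expR_ge0// ltW.
  have : 0 <= eps * z.2 by rewrite mulr_ge0// ltW.
  lra.
rewrite leNgt; apply/negP => neg1.
have T0 : 0 < N.+1%:R :> R by rewrite ltr0n.
have [K cK uK] := u_far _ T0.
(* The slab ends at N+1 because the growth of [s 0] takes over only from there on. *)
pose S := K `*` `[0 : R, N.+1%:R].
pose w z := sg * u z - phi z.
have w_far z : 0 <= z.2 -> ~ S z -> 0 <= w z.
  case: z => p t /= t0 nS; rewrite /w subr_ge0; have [tN|Nt] := leP t N.+1%:R.
    rewrite uK ?t0//; last first.
      by move=> Kp; apply: nS; split => //=; rewrite in_itv/= t0.
    by have := phi_le (p, t) t0; have := s0 0%N t; rewrite /=; lra.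
  (* So that n+1 <= t < n+2. *)
  pose n := (Num.truncn t).-1.
  have Nn : (N.+1 <= Num.truncn t)%N by rewrite truncn_ge_nat// ltW.
  have nE : n.+1 = Num.truncn t by rewrite /n prednK// (leq_trans _ Nn).
  have := truncn_itv t0; rewrite -nE => /andP[nt /ltW tn].
  have := lbP n p t; rewrite t0 tn => /(_ isT).
  have Nn' : (N <= n)%N by rewrite -ltnS nE.
  have := sgrow n t Nn' nt.
  by have := phi_le (p, t) t0; rewrite /=; lra.
have w1 : w (p1, t1) < 0.
  by rewrite /w subr_lt0 phiE /= sN// addr0.
have w_init p : 0 <= w (p, 0).
  have [_ _ ui _ _] := flow.
  have -> : w (p, 0) = sg * u0 p - (d + be * expR (k * level a (p, 0))).
    by rewrite /w phiE /= mulr0 sN ?ler0n// addr0 subr0 ui.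
  have -> : level a (p, 0) = gauge4 p + a * p.1.1 by rewrite /gauge4 /level /=; ring.
  by rewrite subr_ge0.
have S1 : S (p1, t1).
  by have [//|/(w_far (p1, t1) t10)] := pselect (S (p1, t1)); rewrite leNgt w1.
have [|||z zS zmin] := @compact_EVT_min _ _ w S.
- by exists (p1, t1).
- exact: slab_compact.
- by apply: within_slab => z; exact: continuous_eval.
rewrite inE in zS.
have wz : w z < 0 by apply: le_lt_trans w1; apply: zmin; rewrite inE.
have z0 : 0 < z.2.
  have [_ ] := zS; rewrite /= in_itv/= => /andP[].
  rewrite le_eqVlt => /predU1P[zt0 _|//].
  by move: wz; rewrite (surjective_pairing z) -zt0 ltNge w_init.
have zmin' y : 0 <= y.2 -> w z <= w y.
  move=> y0; have [Sy|nSy] := pselect (S y); first by apply: zmin; rewrite inE.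
  by rewrite (le_trans (ltW wz))// w_far.
(* Rotating (p1, p2) to (rho, 0) changes neither u nor any term of G except a p1, so minimality
   gives rho <= p1. *)
have [z1 z2] : 0 <= z.1.1.1 /\ z.1.1.2 = 0.
  pose rho := Num.sqrt (z.1.1.1 ^+ 2 + z.1.1.2 ^+ 2).
  have rhoE : rho ^+ 2 = z.1.1.1 ^+ 2 + z.1.1.2 ^+ 2.
    by rewrite sqr_sqrtr// addr_ge0 ?sqr_ge0.
  have rho0 : 0 <= rho by exact: sqrtr_ge0.
  have := zmin' (rho, 0, z.1.2, z.2) (ltW z0).
  have [_ uax _ _ _] := flow.
  have -> : w (rho, 0, z.1.2, z.2) = sg * u z - phi (rho, 0, z.1.2, z.2).
    congr (sg * _ - _); rewrite [in RHS](surjective_pairing z).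
    by apply: (uax _ (ltW z0)) => //=; rewrite rhoE expr0n addr0.
  rewrite /w lerD2l lerN2 !phiE lerD2r lerD2l ler_nM2l// ler_expR ler_nM2l//.
  rewrite /level /= expr0n /= addr0 rhoE lerD2l ler_pM2l// => rz1.
  have z1 : 0 <= z.1.1.1 by exact: le_trans rz1.
  split => //; apply/eqP; rewrite -sqrf_eq0 eq_le sqr_ge0 andbT.
  have : rho ^+ 2 <= z.1.1.1 ^+ 2 by rewrite ler_sqr.
  by rewrite rhoE gerDl.
have be_neq0 : be != 0 by rewrite lt_eqF.
have k_neq0 : k != 0 by rewrite lt_eqF.
have sphiE y : sphi y = sg * phi y by rewrite /sphi /phi !eval_barrier mul1r.
have := flow_touching phi sphi z (smooth_eval _ _ ds _ _) sphiE z0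
  (fun y y0 => zmin' y (ltW y0))
  (barrier_hgrad_neq0 _ _ ds sg a d be k eps z sg0 be_neq0 k_neq0 a0 z1 z2 (ltW z0)).
rewrite (barrier_operator _ _ ds sg a d be k eps z)// ?(ltW z0)//.
rewrite mulrN mulrA sg2 mul1r oppr_ge0.
by have := s0 2%N z.2; lra.
Qed.

End Comparison.

(** * Choice of the constants and extinction *)

Theorem theorem7p3 (R : realType) (Gamma : R -> set (heis R)) (r : R) :
  axisymmetric_evolution Gamma -> 0 < r -> Gamma 0 `<=` gauge_ball r ->
  forall t : R, r ^+ 2 / Num.sqrt 12 < t -> Gamma t = set0.
Proof.
move=> [_ _ [u0 [u [[cu0 u0ax [K [cK [c u0c]]] G0] flow Gt]]]] r0 G0r t.
have s12 : 0 < Num.sqrt 12 :> R by rewrite sqrtr_gt0.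
rewrite ltr_pdivrMr// => rt.
have r20 : 0 < r ^+ 2 by rewrite exprn_gt0.
have t0 : 0 < t by move: (lt_trans r20 rt); rewrite pmulr_lgt0.
have r4t : r ^+ 4 < 12 * t ^+ 2.
  have -> : 12 * t ^+ 2 = (t * Num.sqrt 12) ^+ 2.
    by rewrite exprMn sqr_sqrtr// mulrC.
  have -> : r ^+ 4 = (r ^+ 2) ^+ 2 by rewrite -exprM.
  by rewrite ltr_sqr// nnegrE ltW// (lt_trans r20).
have r40 : 0 < r ^+ 4 by rewrite exprn_gt0.
have zero_in p : u0 p = 0 -> gauge4 p < r ^+ 4.
  by move=> up; apply: gauge_ball_gauge4 => //; apply: G0r; rewrite G0.
(* Otherwise [u0] would vanish at points of arbitrarily large gauge. *)
have c0 : c != 0.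
  apply/eqP => cE; have [p nKp] := compact_escape _ K (r ^+ 4) cK.
  by rewrite leNgt zero_in// -cE; exact: u0c.
pose sg : R := Num.sg c.
have sgE : sg = 1 \/ sg = -1.
  by rewrite /sg; have [?|?|/eqP] := ltgtP c 0;
    [right; rewrite ltr0_sg|left; rewrite gtr0_sg|rewrite (negPf c0)].
have sg0 : sg != 0 by case: sgE => ->; rewrite ?oppr_eq0 oner_eq0.
have sgc0 : 0 < sg * c by rewrite -normrEsg normr_gt0.
(* The constant for each T equals c: both are read off at time 0 at a point outside the two compact
   sets. *)
have u_far T : 0 < T -> exists2 K : set (heis R), compact K &
    forall p t, ~ K p -> 0 <= t <= T -> u (p, t) = c.
  have [_ _ ui _ far] := flow => T0.
  have [K' [cK' [c' uc']]] := far T T0.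
  exists K' => // p x nK'p xT; rewrite (uc' p x)//.
  have [q nKq _] := compact_escape _ (K `|` K') 0 (compactU cK cK').
  rewrite -(u0c q); last by move=> Kq; apply: nKq; left.
  rewrite -ui (uc' q 0)//; first by move=> K'q; apply: nKq; right.
  by rewrite lexx ltW.
have [|||d [M [d0 dc M0 Mv dv]]] := @initial_lbound R (fun p => sg * u0 p) K
    (sg * c) (r ^+ 4) _ cK _ sgc0 r40.
- by move=> p; apply: cvgM; [exact: cvg_cst|exact: cu0].
- by move=> p /u0c ->.
- by move=> p /eqP; rewrite mulf_eq0 (negPf sg0) => /eqP; exact: zero_in.
(* The barrier uses h(x) = d - C exp(k (s1 - x)), with threshold s1 strictly between r^4 and 12
   t^2. *)
pose s1 := (r ^+ 4 + 12 * t ^+ 2) / 2.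
have s1r : r ^+ 4 < s1 by rewrite /s1; lra.
have s1t : 0 < 12 * t ^+ 2 - s1 by rewrite /s1; lra.
(* In the ball p1 < r, so at time 0 one has G < r^4 + a r = s1 there. *)
pose a := (s1 - r ^+ 4) / r.
have a0 : 0 < a by rewrite divr_gt0// subr_gt0.
(* For x <= s1 this makes h(x) <= d - C = - M, a lower bound of [sg u0]. *)
pose C := M + d.
have C0 : 0 < C by rewrite /C; lra.
(* Then k (12 t^2 - s1) = 2 C / d, and C exp(- 2 C / d) <= d / 2. With eps t = d / 4 the barrier is
   at least d / 4 at time t where p1 >= 0. *)
pose k := 2 * C / (d * (12 * t ^+ 2 - s1)).
have k0 : 0 < k by rewrite divr_gt0// mulr_gt0.
pose eps := d / (4 * t).
have eps0 : 0 < eps by rewrite divr_gt0// mulr_gt0.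
pose N := (Num.truncn t).+1.
have tN : t <= N%:R by rewrite ltW// truncnS_gt.
have expE (x : R) : - C * expR (k * s1) * expR (- k * x) = - C * expR (k * (s1 - x)).
  by rewrite -mulrA -expRD; congr (_ * expR _); ring.
have main p x : 0 <= x <= N%:R ->
    d - C * expR (k * (s1 - level a (p, x))) - eps * x <= sg * u (p, x).
  move=> xN; rewrite -mulNr -expE.
  apply: (barrier_le _ _ _ _ _ flow sgE u_far _ _ _ _ _ N a0 _ _ eps0 dc) => //.
  - by rewrite mulNr oppr_lt0 mulr_gt0// expR_gt0.
  - by rewrite oppr_lt0.
  move=> q; rewrite expE; have [rq|qr] := leP (r ^+ 4) (gauge4 q).
    apply: le_trans (dv _ rq); rewrite gerDl mulNr oppr_le0.
    by rewrite mulr_ge0 ?expR_ge0// ltW.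
  apply: le_trans (Mv q); rewrite /C.
  suff : 1 <= expR (k * (s1 - (gauge4 q + a * q.1.1))).
    by move: (expR _) => E E1; have := ler_wpM2l (ltW C0) E1; rewrite /C; lra.
  rewrite -[leLHS]expR0 ler_expR mulr_ge0// ?(ltW k0)// subr_ge0.
  have q1r : q.1.1 < r.
    have [q0|q0] := leP q.1.1 0; first exact: le_lt_trans r0.
    rewrite -(@ltr_pXn2r _ 4)// ?nnegrE ?ltW//; apply: le_lt_trans qr.
    rewrite /gauge4; have := sqr_ge0 q.1.1; have := sqr_ge0 q.1.2.
    have := sqr_ge0 q.2; have -> : q.1.1 ^+ 4 = (q.1.1 ^+ 2) ^+ 2 by rewrite -exprM.
    by move: (q.1.1 ^+ 2) (q.1.2 ^+ 2) (q.2 ^+ 2) => x1 x2 x3 *; nra.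
  have : a * q.1.1 <= a * r by rewrite ler_pM2l// ltW.
  by rewrite {2}/a divfK ?gt_eqF//; lra.
rewrite Gt ?ltW//; apply/seteqP; split=> // p /= up.
(* By axisymmetry a zero of u can be moved to p2 = 0, p1 >= 0, where G >= 12 t^2. *)
pose rho := Num.sqrt (p.1.1 ^+ 2 + p.1.2 ^+ 2).
have rhoE : rho ^+ 2 = p.1.1 ^+ 2 + p.1.2 ^+ 2.
  by rewrite sqr_sqrtr// addr_ge0 ?sqr_ge0.
have u_rho : u (rho, 0, p.2, t) = 0.
  have [_ uax _ _ _] := flow.
  rewrite -[RHS]up; apply: (uax t (ltW t0) p (rho, 0, p.2)) => //.
  by rewrite /= rhoE expr0n addr0.
have := main (rho, 0, p.2) t; rewrite u_rho mulr0 tN ltW// => /(_ isT).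
have level_ge : 12 * t ^+ 2 <= level a (rho, 0, p.2, t).
  rewrite /level /= expr0n /= addr0.
  have := sqr_ge0 (rho ^+ 2); have := mulr_ge0 (ltW t0) (sqr_ge0 rho).
  have := sqr_ge0 p.2; have := mulr_ge0 (ltW a0) (sqrtr_ge0 _ : 0 <= rho).
  by lra.
have eps_t : eps * t = d / 4 by rewrite /eps; field; rewrite gt_eqF.
have : expR (k * (s1 - level a (rho, 0, p.2, t))) <= expR (- (2 * C / d)).
  rewrite ler_expR.
  have -> : 2 * C / d = k * (12 * t ^+ 2 - s1).
    by rewrite /k; field; rewrite !gt_eqF.
  by rewrite -mulrN ler_pM2l//; lra.
have : C * expR (- (2 * C / d)) <= d / 2.
  rewrite expRN ler_pdivrMr ?expR_gt0//.
  apply: (@le_trans _ _ (d / 2 * (1 + 2 * C / d))).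
    have -> : d / 2 * (1 + 2 * C / d) = d / 2 + C by field; rewrite gt_eqF.
    by lra.
  by rewrite ler_pM2l ?divr_gt0// expR_ge1Dx.
rewrite eps_t; move: (expR _) (expR _) => E1 E2 h1 h2 h3.
by have := ler_wpM2l (ltW C0) h2; lra.
Qed.
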